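(* Consider an $m$-strategy CRS game ($m\ge2$) on a complete network with $n$ players, of whom $c\ge 1$ are conformists, and let $s_k$ be the number of stubborn agents with fixed strategy $a_k$, with strategies labelled so that $s_1\le s_2\le\dots\le s_m$. The game admits a pure strategy Nash equilibrium (PNE) if and only if one of the following conditions holds: (i) $s_m+c>\left\lceil (n-c-s_m)/(m-1)\right\rceil$; (ii) $s_m+c\le \left\lceil (n-c-s_m)/(m-1)\right\rceil$ and $n\equiv 1\pmod m$.
   Context: An $m$-strategy CRS game consists of a finite set of players $N=C\cup R\cup S$ (disjoint union of conformists $C$, rebels $R$ and stubborn agents $S$), a set $E\neq\emptyset$ of undirected edges on $N$ without loops, and a strategy set $A=\{a_1,\dots,a_m\}$ common to all players. $N_i=\{j: ij\in E\}$ is the set of neighbors of $i$. On a complete network every two distinct players are neighbors. Each stubborn agent has a predetermined fixed strategy in $A$ which it never changes, so strategy profiles $\boldsymbol x\in A^N$ always have $x_i$ equal to the fixed strategy for $i\in S$. Payoffs are $u_i(\boldsymbol x)=|\{j\in N_i: x_j=x_i\}|$ for $i\in C$, $u_i(\boldsymbol x)=|\{j\in N_i: x_j\ne x_i\}|$ for $i\in R$, and $u_i(\boldsymbol x)=0$ for $i\in S$. A profile $\boldsymbol x^*$ is a PNE if no conformist or rebel $i$ can strictly increase $u_i$ by unilaterally changing its strategy: $u_i(\boldsymbol x^* )\ge u_i(x_i,\boldsymbol x^*_{-i})$ for all $x_i\in A$. $\lceil\cdot\rceil$ is the ceiling function. *)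

(* Defs.v *)
From HB Require Import structures.
From mathcomp Require Import all_boot all_order all_algebra.

Set Implicit Arguments.
Unset Strict Implicit.
Unset Printing Implicit Defensive.

(* The strategies a_1, ..., a_m are the ordinals 0, ..., m - 1 of 'I_m. *)

(* A stubborn agent carries its predetermined strategy, so a function from
   players to kinds is a disjoint partition N = C + R + S together with the
   fixed strategies of S. *)
Variant kind (m : nat) := Conformist | Rebel | Stubborn of 'I_m.
Arguments Conformist {m}.
Arguments Rebel {m}.

Record crs_game (m : nat) := CRSGame {
  player : finType;
  player_kind : player -> kind m;
  edge : rel player;
  edge_sym : symmetric edge;
  edge_irrefl : irreflexive edge;
  edge_nonempty : exists i j, edge i j
}.

Section Game.
Variables (m : nat) (G : crs_game m).
Local Notation N := (player G).

Definition conformists : {set N} :=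
  [set i | if player_kind i is Conformist then true else false].

Definition rebels : {set N} :=
  [set i | if player_kind i is Rebel then true else false].

Definition stubborn_with (k : 'I_m) : {set N} :=
  [set i | if player_kind i is Stubborn a then a == k else false].

Definition neighbors (i : N) : {set N} := [set j | edge i j].

Definition complete_network : Prop := forall i j : N, i != j -> edge i j.

Definition profile := {ffun N -> 'I_m}.

Definition admissible (x : profile) : Prop :=
  forall (i : N) (a : 'I_m), player_kind i = Stubborn a -> x i = a.

Definition payoff (x : profile) (i : N) : nat :=
  match player_kind i with
  | Conformist => #|[set j in neighbors i | x j == x i]|
  | Rebel => #|[set j in neighbors i | x j != x i]|
  | Stubborn _ => 0
  end.

Definition deviate (x : profile) (i : N) (a : 'I_m) : profile :=
  [ffun j => if j == i then a else x j].

Definition PNE (x : profile) : Prop :=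
  admissible x /\
  forall i : N, i \in conformists :|: rebels ->
  forall a : 'I_m, payoff (deviate x i a) i <= payoff x i.

End Game.

Lemma last_strategy_subproof (m : nat) : 1 < m -> m.-1 < m.
Proof. by case: m. Qed.

(* The strategy a_m. *)
Definition last_strategy (m : nat) (hm : 1 < m) : 'I_m :=
  Ordinal (last_strategy_subproof hm).

(* Main.v *)
Require Import Defs.
From HB Require Import structures.
From mathcomp Require Import all_boot all_order all_algebra.
From mathcomp Require Import zify lra.
Set Implicit Arguments.
Unset Strict Implicit.
Unset Printing Implicit Defensive.
Import Order.TTheory GRing.Theory Num.Theory.
Local Open Scope ring_scope.

(** Let n_k be the number of players using strategy k.  On a complete network a
    profile is a PNE iff n_l < n_k for all l <> k whenever a conformist plays k,
    and n_k <= n_l + 1 for all l whenever a rebel plays k.  So all conformists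
    share the strictly most frequent strategy k.  If a rebel plays k too, all
    other strategies are used exactly n_k - 1 times and n = 1 mod m; otherwise
    n_k <= s_k + c, and bounding the other n_l by n_k - 1 gives (i).
    Conversely, put all conformists on a_m and let the rebels successively join
    a currently least used strategy: among the strategies other than a_m in case
    (i), and among all strategies, after setting one conformist aside, in case
    (ii). *)

(** * Distributing elements evenly over cells with given initial loads *)

Section Counting.
Local Open Scope nat_scope.

Lemma sum_in_setT (I : finType) (F : I -> nat) :
  \sum_(i in [set: I]) F i = \sum_i F i.
Proof. by apply: eq_bigl => i; rewrite inE. Qed.

Lemma sum_card_fibers (T I : finType) (A : {set T}) (P : {set I}) (f : T -> I) :
  {in A, forall i, f i \in P} ->
  \sum_(k in P) #|[set i in A | f i == k]| = #|A|.
Proof.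
move=> fP; rewrite -[RHS]sum1_card (partition_big f (mem P)) //=.
apply: eq_bigr => k _; rewrite -sum1_card; apply: eq_bigl => i.
by rewrite inE.
Qed.

(** Induction on [#|A|]: each new element joins a least loaded cell of [P]. This raises a minimal
    load by one, so no cell that has received an element exceeds another cell of [P] by more than
    one. *)
Lemma balanced_filling (T I : finType) (P : {set I}) (b : I -> nat)
    (A : {set T}) (p0 : I) : p0 \in P ->
  exists f : T -> I, let h l := b l + #|[set i in A | f i == l]| in
    {in A, forall i, f i \in P} /\ {in A & P, forall i l, h (f i) <= h l + 1}.
Proof.
move=> p0P; have [n] := ubnP #|A|.
elim: n A => // n IHn A; rewrite ltnS => leAn.
have [->|[i iA]] := set_0Vmem A.
  by exists (fun=> p0); split=> [i|i l]; rewrite inE.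
have [|f [fP fbal]] := IHn (A :\ i).
  by rewrite (cardsD1 i A) iA in leAn.
set h := fun l => b l + #|[set j in A :\ i | f j == l]|.
have [l lP lmin] := arg_minnP h p0P.
exists (fun j => if j == i then l else f j) => h'.
have h'E k : h' k = h k + (k == l).
  rewrite /h' /h (cardsD1 i) !inE eqxx iA /= eq_sym -addnA addnCA addnC.
  rewrite -addnA; congr (_ + (_ + _)); apply: eq_card => j.
  by rewrite !inE; case: eqP.
split=> [j jA|j k jA kP].
  by case: eqP => [//|/eqP ji]; apply: fP; rewrite !inE ji.
rewrite !h'E; case: eqP => [_|/eqP ji].
  by rewrite eqxx; move: (lmin k kP); lia.
have := fbal j k _ kP; rewrite !inE ji jA -/(h _) -/(h _) => /(_ isT).
(* If [j] already sits in [l], the balance of [h] falls short by one, and the minimality of [l]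
   takes its place. *)
have [->|_] := eqVneq (f j) l; last by lia.
by move: (lmin k kP); lia.
Qed.

(** A cell above [Q] starts at most at [Q], so it has received an element; balance then puts every
    cell at [Q] or more, and the total load exceeds the capacity [#|P| * Q]. *)
Lemma bounded_filling (T I : finType) (P : {set I}) (b : I -> nat)
    (A : {set T}) (Q : nat) :
    {in P, forall l, b l <= Q} -> \sum_(l in P) b l + #|A| <= #|P| * Q ->
    0 < #|P| ->
  exists f : T -> I, let h l := b l + #|[set i in A | f i == l]| in
    [/\ {in A, forall i, f i \in P}, {in P, forall l, h l <= Q}
      & {in A & P, forall i l, h (f i) <= h l + 1}].
Proof.
move=> bQ sumQ /card_gt0P[p0 p0P].
have [f [fP fbal]] := balanced_filling b A p0P.
exists f => h; split=> // l lP; rewrite leqNgt; apply/negP => Qh.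
have [i] : exists i, i \in [set i in A | f i == l].
  by apply/card_gt0P; move: (bQ l lP) Qh; rewrite /h; lia.
rewrite inE => /andP[iA /eqP fil].
have hQ k : k \in P -> Q <= h k.
  by move=> kP; move: (fbal i k iA kP); rewrite fil -/(h l) -/(h k); lia.
have hsum : \sum_(k in P) h k <= #|P| * Q.
  by rewrite big_split /= sum_card_fibers.
have : #|P| * Q < \sum_(k in P) h k.
  rewrite -sum_nat_const (bigD1 l) //= [X in _ < X](bigD1 l) //= -addSn.
  by rewrite leq_add // leq_sum // => k /andP[kP _]; apply: hQ.
by rewrite ltnNge hsum.
Qed.

End Counting.

(** * Equilibria in terms of strategy counts, and necessity *)

Section CompleteNetwork.
Local Open Scope nat_scope.
Variables (m : nat) (G : crs_game m).
Hypothesis hcomplete : complete_network G.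

Definition players_of (x : profile G) (k : 'I_m) : {set player G} :=
  [set j | x j == k].

Lemma sum_players_of (x : profile G) :
  \sum_k #|players_of x k| = #|player G|.
Proof.
rewrite -[RHS]cardsT -(@sum_card_fibers _ _ setT setT x) => [|i]; last by rewrite inE.
by rewrite sum_in_setT; apply: eq_bigr => k _; apply: eq_card => j; rewrite !inE.
Qed.

Lemma complete_edge (i j : player G) : edge i j = (i != j).
Proof.
by have [->|/hcomplete->//] := eqVneq; rewrite edge_irrefl.
Qed.

Lemma card_neighbors_same (x : profile G) (i : player G) :
  #|[set j in neighbors i | x j == x i]|.+1 = #|players_of x (x i)|.
Proof.
rewrite (cardsD1 i (players_of _ _)) inE eqxx add1n; congr _.+1.
by apply: eq_card => j; rewrite !inE complete_edge eq_sym.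
Qed.

Lemma card_neighbors_diff (x : profile G) (i : player G) :
  #|[set j in neighbors i | x j != x i]| + #|players_of x (x i)| = #|player G|.
Proof.
rewrite -(cardsC (players_of x (x i))) addnC; congr (_ + _).
apply: eq_card => j; rewrite !inE complete_edge.
by have [->|] := eqVneq i j; rewrite ?eqxx.
Qed.

Lemma players_of_deviate (x : profile G) (i : player G) (a : 'I_m) :
  a != x i -> #|players_of (deviate x i a) a| = #|players_of x a|.+1.
Proof.
move=> axi; rewrite (cardsD1 i) inE ffunE !eqxx add1n; congr _.+1.
apply: eq_card => j; rewrite !inE ffunE.
by have [->|] := eqVneq j i; rewrite //= eq_sym (negbTE axi).
Qed.

Lemma deviate_id (x : profile G) (i : player G) : deviate x i (x i) = x.
Proof. by apply/ffunP => j; rewrite ffunE; case: eqP => [->|]. Qed.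

Lemma deviate_self (x : profile G) (i : player G) (a : 'I_m) :
  deviate x i a i = a.
Proof. by rewrite ffunE eqxx. Qed.

(** No player is its own neighbor. With n_k the size of class k, a conformist moving from k to a
    trades n_k - 1 for n_a, and a rebel trades n - n_k for n - (n_a + 1). *)
Lemma PNE_counts (x : profile G) :
  PNE x <->
  [/\ admissible x,
      {in conformists G, forall i a, a != x i ->
        #|players_of x a| < #|players_of x (x i)|}
    & {in rebels G, forall i a, a != x i ->
        #|players_of x (x i)| <= #|players_of x a| + 1}].
Proof.
split=> [[adm opt]|[adm con reb]]; split=> // i.
- move=> iC a axi; have := opt i; rewrite inE iC => /(_ isT a).
  move: iC; rewrite inE /payoff; case: (player_kind i) => // _.
  have := card_neighbors_same (deviate x i a) i.
  have := card_neighbors_same x i.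
  by rewrite deviate_self players_of_deviate //; lia.
- move=> iR a axi; have := opt i; rewrite inE iR orbT => /(_ isT a).
  move: iR; rewrite inE /payoff; case: (player_kind i) => // _.
  have := card_neighbors_diff (deviate x i a) i.
  have := card_neighbors_diff x i.
  by rewrite deviate_self players_of_deviate //; lia.
move=> iCR a; have [->|axi] := eqVneq a (x i); first by rewrite deviate_id.
move: iCR; rewrite inE => /orP[iC|iR].
  have := con i iC a axi; move: iC; rewrite inE /payoff.
  case: (player_kind i) => // _.
  have := card_neighbors_same (deviate x i a) i.
  have := card_neighbors_same x i.
  by rewrite deviate_self players_of_deviate //; lia.
have := reb i iR a axi; move: iR; rewrite inE /payoff.
case: (player_kind i) => // _.
have := card_neighbors_diff (deviate x i a) i.
have := card_neighbors_diff x i.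
by rewrite deviate_self players_of_deviate //; lia.
Qed.

Lemma card_players_of (x : profile G) (k : 'I_m) : admissible x ->
  #|players_of x k| = #|[set i in conformists G | x i == k]|
    + #|[set i in rebels G | x i == k]| + #|stubborn_with G k|.
Proof.
move=> adm.
have -> : players_of x k = [set i in conformists G | x i == k]
    :|: [set i in rebels G | x i == k] :|: stubborn_with G k.
  apply/setP => i; rewrite !inE.
  by case E: (player_kind i) => [||a] /=; rewrite ?orbF // (adm i a E).
rewrite !cardsU.
have -> : [set i in conformists G | x i == k] :&: [set i in rebels G | x i == k]
    = set0.
  by apply/setP => i; rewrite !inE; case: (player_kind i); rewrite ?andbF.
have -> : ([set i in conformists G | x i == k]
    :|: [set i in rebels G | x i == k]) :&: stubborn_with G k = set0.
  by apply/setP => i; rewrite !inE; case: (player_kind i); rewrite ?andbF.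
by rewrite cards0 !subn0.
Qed.

(** The common shape of both equilibria constructed below: conformists gather on [k0], and only the
    values of [f] at rebels matter. *)
Definition fill_profile (k0 : 'I_m) (f : player G -> 'I_m) : profile G :=
  [ffun i => match player_kind i with
             | Conformist => k0 | Rebel => f i | Stubborn a => a end].

Lemma fill_profile_admissible k0 f : admissible (fill_profile k0 f).
Proof. by move=> i a E; rewrite ffunE E. Qed.

Lemma fill_profile_conformist k0 f i :
  i \in conformists G -> fill_profile k0 f i = k0.
Proof. by rewrite inE ffunE; case: (player_kind i). Qed.

Lemma fill_profile_rebel k0 f i : i \in rebels G -> fill_profile k0 f i = f i.
Proof. by rewrite inE ffunE; case: (player_kind i). Qed.

Lemma card_players_of_fill k0 f k :
  #|players_of (fill_profile k0 f) k| =
  (if k == k0 then #|conformists G| else 0)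
  + #|[set i in rebels G | f i == k]| + #|stubborn_with G k|.
Proof.
rewrite card_players_of; last exact: fill_profile_admissible.
congr (_ + _ + _).
  case: eqP => [->|/eqP kk0].
    apply: eq_card => i; rewrite !inE ffunE.
    by case: (player_kind i); rewrite ?eqxx.
  apply/eqP; rewrite cards_eq0; apply/eqP/setP => i; rewrite !inE ffunE.
  by case: (player_kind i); rewrite // eq_sym (negbTE kk0).
by apply: eq_card => i; rewrite !inE ffunE; case: (player_kind i).
Qed.

(** [M] stands for s_m + c, and the first alternative is condition (i) cleared of its ceiling and
    its denominator. *)
Lemma PNE_necessary (x : profile G) (M : nat) :
    PNE x -> 0 < #|conformists G| ->
    (forall k, #|stubborn_with G k| + #|conformists G| <= M) ->
  #|player G| + m.-1 <= m * M \/ #|player G| = 1 %[mod m].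
Proof.
move=> /PNE_counts[adm con reb] /card_gt0P[i0 i0C] leM.
set k := x i0; set p := #|players_of x k|.
have sumE : #|player G| = p + \sum_(l | l != k) #|players_of x l|.
  by rewrite -(sum_players_of x) (bigD1 k).
have cardE : \sum_(l : 'I_m | l != k) p.-1 = m.-1 * p.-1.
  rewrite sum_nat_const; congr (_ * _).
  by rewrite -[in RHS](card_ord m) -(cardC1 k); apply: eq_card => l; rewrite !inE.
have p_gt0 : 0 < p by apply/card_gt0P; exists i0; rewrite inE.
have m_gt0 : 0 < m := leq_ltn_trans (leq0n k) (ltn_ord k).
have mpE : m * p = m.-1 * p.-1 + m.-1 + p by nia.
(* Either no rebel plays [k], and then only conformists and stubborn agents make up [p], or some
   rebel [j] does. *)
have [r0|[j]] := set_0Vmem [set i in rebels G | x i == k].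
  left; have pM : p <= M.
    rewrite /p card_players_of // r0 cards0 addn0 addnC.
    by apply: leq_trans (leM k); rewrite leq_add2l subset_leq_card //
      setIdE subsetIl.
  have : \sum_(l | l != k) #|players_of x l| <= m.-1 * p.-1.
    rewrite -cardE; apply: leq_sum => l lk.
    by have := con i0 i0C l lk; rewrite -/k -/p; lia.
  have : m * p <= m * M by rewrite leq_mul2l pM orbT.
  by lia.
rewrite inE => /andP[jR /eqP jk]; right.
(* The conformist [i0] forces every other class below [p], the rebel [j] forces it to be at least
   [p.-1]. *)
have eqs : \sum_(l | l != k) #|players_of x l| = m.-1 * p.-1.
  rewrite -cardE; apply: eq_bigr => l lk.
  have := reb j jR l; rewrite jk => /(_ lk).
  by have := con i0 i0C l lk; rewrite -/k -/p; lia.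
have -> : #|player G| = p.-1 * m + 1 by rewrite sumE eqs; nia.
by rewrite modnMDl.
Qed.

(** * Sufficiency: construction of equilibria *)

Lemma sum_stubborn (k0 : 'I_m) :
  \sum_k #|stubborn_with G k| + #|conformists G| + #|rebels G| = #|player G|.
Proof.
rewrite -(sum_players_of (fill_profile k0 (fun=> k0))).
under [RHS]eq_bigr => k _ do rewrite card_players_of_fill.
rewrite !big_split /= -big_mkcond big_pred1_eq.
have /= := @sum_card_fibers _ _ (rebels G) setT (fun=> k0).
rewrite sum_in_setT => -> => [|i]; last by rewrite inE.
by rewrite -addnA addnC.
Qed.

Lemma PNE_of_many_conformists (k0 : 'I_m) : 1 < m ->
    0 < #|conformists G| ->
    (forall k, #|stubborn_with G k| <= #|stubborn_with G k0|) ->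
    #|player G| + m.-1 <= m * (#|stubborn_with G k0| + #|conformists G|) ->
  exists x : profile G, PNE x.
Proof.
move=> m_gt1 c_gt0 k0max large.
set M := #|stubborn_with G k0| + #|conformists G| in large *.
have cardP : #|[set~ k0]| = m.-1 by rewrite cardsC1 card_ord.
(* Capacity [M.-1] keeps every other class strictly below [k0], which has at least [M] players. *)
have [|||f [fP fQ fbal]] := @bounded_filling _ _ [set~ k0]
    (fun k => #|stubborn_with G k|) (rebels G) M.-1.
- by move=> k _; have := k0max k; rewrite /M; lia.
- rewrite cardP; have := sum_stubborn k0; rewrite (bigD1 k0) //=.
  rewrite (eq_bigl (fun k => k \in [set~ k0])) => [|k]; last by rewrite !inE.
  have M_gt0 : 0 < M by rewrite /M; lia.
  (* By this identity [large] says that the n - M players to be placed off [k0], stubborn agents and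
     rebels, fit into [m.-1] classes of capacity [M.-1]. *)
  have : m * M = m.-1 * M.-1 + m.-1 + M by nia.
  have ME : M = #|stubborn_with G k0| + #|conformists G| by [].
  move: large ME; clearbody M; move: (\sum_(i in _) _) #|player G| #|rebels G|.
  by move: #|conformists G| #|stubborn_with G k0| => *; lia.
- by rewrite cardP; lia.
have cntE k : k != k0 -> #|players_of (fill_profile k0 f) k| =
    #|stubborn_with G k| + #|[set i in rebels G | f i == k]|.
  by move=> kk0; rewrite card_players_of_fill (negbTE kk0) addnC.
have cnt0 : M <= #|players_of (fill_profile k0 f) k0|.
  by rewrite card_players_of_fill eqxx /M; lia.
have lt0 k : k != k0 ->
    #|players_of (fill_profile k0 f) k| < #|players_of (fill_profile k0 f) k0|.
  move=> kk0; apply: leq_trans cnt0; rewrite cntE //.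
  by have := fQ k; rewrite !inE kk0 => /(_ isT); rewrite /M; lia.
exists (fill_profile k0 f); apply/PNE_counts; split.
- exact: fill_profile_admissible.
- by move=> i iC a; rewrite (fill_profile_conformist _ _ iC) => /lt0.
move=> i iR a; rewrite (fill_profile_rebel _ _ iR) => afi.
have := fP i iR; rewrite !inE => fi0.
(* A rebel gains nothing on [k0], the largest class; among the other strategies the filling is
   balanced. *)
have [->|a0] := eqVneq a k0; first by have := lt0 _ fi0; lia.
by rewrite !cntE //; apply: fbal => //; rewrite !inE.
Qed.

Lemma PNE_of_mod (k0 : 'I_m) (t : nat) : 0 < #|conformists G| ->
    (forall k, #|stubborn_with G k| <= #|stubborn_with G k0|) ->
    #|stubborn_with G k0| + #|conformists G| <= t ->
    #|player G| = m * t + 1 ->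
  exists x : profile G, PNE x.
Proof.
move=> c_gt0 k0max small nE.
(* One conformist is left out, so that the remaining [m * t] players can fill every class to exactly
   [t]; adding it back gives [k0] size t + 1. *)
pose b k := #|stubborn_with G k| + (if k == k0 then #|conformists G|.-1 else 0).
have sumb : \sum_(l in setT) b l + #|rebels G| = m * t.
  rewrite sum_in_setT big_split /= -big_mkcond big_pred1_eq.
  have := sum_stubborn k0; move: nE c_gt0; move: (\sum_(i < m) _) #|player G|.
  by move: #|rebels G| #|conformists G| => *; lia.
have [|||f [fP fQ _]] := @bounded_filling _ _ setT b (rebels G) t.
- by move=> k _; have := k0max k; rewrite /b; case: ifP => _; lia.
- by rewrite sumb cardsT card_ord.
- by apply/card_gt0P; exists k0; rewrite inE.
have sumh : \sum_(l in setT) (b l + #|[set i in rebels G | f i == l]|) = m * t.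
  by rewrite big_split /= sum_card_fibers.
(* The [m] loads are at most [t] and sum to [m * t], so all of them equal [t]. *)
have hE l : b l + #|[set i in rebels G | f i == l]| = t.
  apply/eqP; have := @leqif_sum _ (mem [set: 'I_m])
    (fun l => b l + #|[set i in rebels G | f i == l]| == t)
    (fun l => b l + #|[set i in rebels G | f i == l]|) (fun=> t).
  case=> [k kT|_]; first by split; first exact: fQ.
  rewrite sumh sum_nat_const cardsT card_ord eqxx => /esym/forall_inP.
  by apply; rewrite inE.
have cntE k : #|players_of (fill_profile k0 f) k| = t + (k == k0).
  rewrite card_players_of_fill -(hE k) /b; move: c_gt0.
  move: #|conformists G| #|[set _ in _ | _]| #|stubborn_with G k|.
  by case: eqP => _ * /=; lia.
exists (fill_profile k0 f); apply/PNE_counts; split.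
- exact: fill_profile_admissible.
- move=> i iC a; rewrite (fill_profile_conformist _ _ iC) !cntE eqxx.
  by move/negbTE->; lia.
by move=> i iR a _; rewrite !cntE; case: eqP; case: eqP; lia.
Qed.

End CompleteNetwork.

(** * From the ceiling condition to an inequality of natural numbers *)

Lemma ceil_div_lt (n m M : nat) : (1 < m)%N ->
  (Num.ceil ((n%:R - M%:R) / (m%:R - 1) : rat) < M%:Z) =
  (n + m.-1 <= m * M)%N.
Proof.
case: m => [//|[//|m]] _ /=; set d := _ - 1.
have dE : d = m.+1%:R by rewrite /d -[m.+2]addn1 natrD addrK.
(* For an integer bound, the ceiling is below M iff the quotient is at most M - 1; multiplying by m
   - 1 > 0 gives n - M <= (m - 1)(M - 1), which rearranges to the claim. *)
rewrite -[M%:Z](subrK 1) ltzD1 ceil_le_int ler_pdivrMr dE ?ltr0n //.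
rewrite -(ler_nat rat) natrM natrD -[m.+2]addn1 natrD intrB /=.
by apply/idP/idP => H; lra.
Qed.

Theorem theorem3 (m : nat) (hm : (1 < m)%N) (G : crs_game m)
    (hcomplete : complete_network G)
    (n c : nat) (s : 'I_m -> nat)
    (hn : n = #|player G|)
    (hc : c = #|conformists G|) (hc1 : (1 <= c)%N)
    (hs : forall k : 'I_m, s k = #|stubborn_with G k|)
    (hsorted : forall k l : 'I_m, (k <= l)%N -> (s k <= s l)%N) :
  let sm := s (last_strategy hm) in
  let q : int := Num.ceil ((n%:R - c%:R - sm%:R) / (m%:R - 1) : rat) in
  (exists x : profile G, PNE x) <->
  (q < (sm + c)%:Z \/ ((sm + c)%:Z <= q /\ n = 1 %[mod m])).
Proof.
move=> sm q.
have qE : (q < (sm + c)%:Z) = (n + m.-1 <= m * (sm + c))%N.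
  by rewrite -ceil_div_lt // /q natrD [in LHS]addrAC opprD addrA.
have smax k : (s k <= sm)%N.
  by apply: hsorted; rewrite /=; have := ltn_ord k; lia.
have stub_max k : (#|stubborn_with G k| <= #|stubborn_with G (last_strategy hm)|)%N.
  by rewrite -!hs; apply: smax.
have c_gt0 : (0 < #|conformists G|)%N by rewrite -hc.
rewrite leNgt qE; split=> [[x xPNE]|].
  have [|i|ii] := PNE_necessary hcomplete (M := (sm + c)%N) xPNE c_gt0.
  - by move=> k; rewrite -hs -hc leq_add2r.
  - by left; rewrite hn.
  by case: leqP => _; [left | right; rewrite hn].
case=> [large|[]].
  apply: (PNE_of_many_conformists hcomplete hm c_gt0 stub_max).
  by rewrite -hn -hc -hs.
rewrite -ltnNge (modn_small hm) => small nmod.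
(* The class size in case (ii) is t = [n %/ m]. Failure of (i) then reads m (s_m + c) < n + m - 1 =
   m (t + 1), that is s_m + c <= t. *)
have nE : n = (m * (n %/ m) + 1)%N by rewrite {1}(divn_eq n m) nmod mulnC.
apply: (PNE_of_mod hcomplete (t := n %/ m) c_gt0 stub_max); last by rewrite -hn.
rewrite -hs -hc -/sm -ltnS -(ltn_pmul2l (ltnW hm)) mulnS.
by move: small; rewrite {1}nE; lia.
Qed.
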